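(* Let $(A,\cdot,\alpha)$ be a Hom-algebra, let $[x,y]=x\cdot y-y\cdot x$ and let $L_\cdot:A\to\mathrm{End}(A)$, $L_\cdot(x)(y)=x\cdot y$. Then $(A,\cdot,\alpha)$ is a Hom-pre-Malcev algebra if and only if $(A,[-,-],\alpha)$ is a Hom-Malcev algebra and $(A,L_\cdot,\alpha)$ is a representation of $(A,[-,-],\alpha)$.
   Context: All vector spaces are over a field $\mathbb K$ of characteristic $0$. A Hom-algebra $(A,\mu,\alpha)$ is a vector space $A$ with a bilinear map $\mu:A\times A\to A$ and a linear map $\alpha:A\to A$; all Hom-algebras are assumed multiplicative, i.e. $\alpha(\mu(x,y))=\mu(\alpha(x),\alpha(y))$. A Hom-Malcev algebra is a Hom-algebra $(A,[-,-],\alpha)$ with $[-,-]$ anti-symmetric and, for all $x,y,z\in A$, $J_\alpha(\alpha(x),\alpha(y),[x,z])=[J_\alpha(x,y,z),\alpha^2(x)]$, where $J_\alpha(x,y,z)=[[x,y],\alpha(z)]+[[y,z],\alpha(x)]+[[z,x],\alpha(y)]$. A representation of a Hom-Malcev algebra $(A,[-,-],\alpha)$ is a triple $(V,\rho,\beta)$ with $V$ a vector space, $\rho:A\to \mathrm{End}(V)$ linear, $\beta\in \mathrm{End}(V)$, such that for all $x,y,z\in A$: $\rho(\alpha(x))\beta=\beta\rho(x)$ and $$\rho([[x,y],\alpha(z)])\beta^2=\rho(\alpha^2(x))\rho(\alpha(y))\rho(z)-\rho(\alpha^2(z))\rho(\alpha(x))\rho(y)+\rho(\alpha^2(y))\rho([z,x])\beta-\rho(\alpha([y,z]))\rho(\alpha(x))\beta.$$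 A Hom-pre-Malcev algebra is a Hom-algebra $(A,\cdot,\alpha)$ such that, with $[x,y]=x\cdot y-y\cdot x$, for all $x,y,z,t\in A$: $$[\alpha(y),\alpha(z)]\cdot\alpha(x\cdot t)+[[x,y],\alpha(z)]\cdot\alpha^2(t)+\alpha^2(y)\cdot([x,z]\cdot\alpha(t))-\alpha^2(x)\cdot(\alpha(y)\cdot(z\cdot t))+\alpha^2(z)\cdot(\alpha(x)\cdot(y\cdot t))=0.$$ *)

(* Defs.v *)
From HB Require Import structures.
From mathcomp Require Import all_boot all_algebra.

Set Implicit Arguments.
Unset Strict Implicit.
Unset Printing Implicit Defensive.

Import GRing.Theory.
Local Open Scope ring_scope.

(* Vector spaces are arbitrary K-modules, hence possibly infinite-dimensional. *)
Record homAlgebra (K : fieldType) (A : lmodType K) := HomAlgebra {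
  hmul : {bilinear A -> A -> A};
  htwist : {linear A -> A};
  htwistM : forall x y, htwist (hmul x y) = hmul (htwist x) (htwist y)
}.

Section Commutator.

Variables (K : fieldType) (A : lmodType K) (H : homAlgebra A).

Definition hcomm (x y : A) : A := hmul H x y - hmul H y x.

Fact hcomm_is_bilinear :
  bilinear_for (GRing.Scale.Law.clone _ _ *:%R _)
    (GRing.Scale.Law.clone _ _ *:%R _) hcomm.
Proof.
by split=> [z a x y | z a x y]; rewrite /= /applyr /hcomm linearPl linearPr scalerBr opprD addrACA.
Qed.

HB.instance Definition _ :=
  bilinear_isBilinear.Build K A A A *:%R *:%R hcomm hcomm_is_bilinear.

Fact hcomm_twistM x y :
  htwist H (hcomm x y) = hcomm (htwist H x) (htwist H y).
Proof. by rewrite /hcomm linearB !htwistM. Qed.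

Definition commAlgebra : homAlgebra A :=
  @HomAlgebra K A hcomm (htwist H) hcomm_twistM.

Lemma commAlgebraE x y : hmul commAlgebra x y = hmul H x y - hmul H y x.
Proof. by []. Qed.

Definition leftMul (x : A) : {linear A -> A} := hmul H x.

End Commutator.

Section Identities.

Variables (K : fieldType) (A : lmodType K) (H : homAlgebra A).

Local Notation alpha := (htwist H).

Definition homJacobian (x y z : A) : A :=
  let br := hmul H in
  br (br x y) (alpha z) + br (br y z) (alpha x) + br (br z x) (alpha y).

Definition isHomMalcev : Prop :=
  let br := hmul H in
  (forall x y, br x y = - br y x) /\
  (forall x y z,
     homJacobian (alpha x) (alpha y) (br x z)
     = br (homJacobian x y z) (alpha (alpha x))).

Definition isHomPreMalcev : Prop :=
  let dot := hmul H in
  let br := hmul (commAlgebra H) in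
  forall x y z t,
    dot (br (alpha y) (alpha z)) (alpha (dot x t))
    + dot (br (br x y) (alpha z)) (alpha (alpha t))
    + dot (alpha (alpha y)) (dot (br x z) (alpha t))
    - dot (alpha (alpha x)) (dot (alpha y) (dot z t))
    + dot (alpha (alpha z)) (dot (alpha x) (dot y t)) = 0.

(* H plays the role of the Hom-Malcev algebra (A, [-,-], alpha); that it is one
   is not part of this predicate.  MathComp has no module structure on
   {linear V -> V}, so linearity of rho and the identities in End(V) are stated
   pointwise. *)
Definition isRepresentation (V : lmodType K) (rho : A -> {linear V -> V})
    (beta : {linear V -> V}) : Prop :=
  let br := hmul H in
  [/\ forall v a x y, rho (a *: x + y) v = a *: rho x v + rho y v,
      forall x v, rho (alpha x) (beta v) = beta (rho x v)
    & forall x y z v,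
        rho (br (br x y) (alpha z)) (beta (beta v))
        = rho (alpha (alpha x)) (rho (alpha y) (rho z v))
          - rho (alpha (alpha z)) (rho (alpha x) (rho y v))
          + rho (alpha (alpha y)) (rho (br z x) (beta v))
          - rho (alpha (br y z)) (rho (alpha x) (beta v))].

End Identities.

(* Main.v *)
(* The Hom-pre-Malcev identity is a rearrangement of the representation identity
   for left multiplications, so only the Hom-Malcev identity of the commutator
   bracket needs an argument.  It is the case a = b of the Hom-Sagle identity
     [al [a,c], al [b,d]] = [[[a,b], al c], al^2 d] + (cyclic in a, b, c, d),
   whose defect is an integral combination of eight permuted instances of the
   Hom-pre-Malcev defect. *)
Require Import Defs.
From HB Require Import structures.
From mathcomp Require Import all_boot all_algebra ring.

Set Implicit Arguments.
Unset Strict Implicit.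
Unset Printing Implicit Defensive.

Import GRing.Theory.
Local Open Scope ring_scope.

(* Embedding A as an additive subgroup of a commutative ring lets [ring] decide
   additive identities in A. *)
Definition squareZeroExt (K : fieldType) (A : lmodType K) : Type := (K * A)%type.

Section SquareZeroExtension.

Variables (K : fieldType) (A : lmodType K).

Local Notation E := (squareZeroExt A).

HB.instance Definition _ := GRing.Zmodule.on E.

Definition sqz_one : E := (1, 0).

Definition sqz_mul (p q : E) : E := (p.1 * q.1, p.1 *: q.2 + q.1 *: p.2).

Fact sqz_mulA : associative sqz_mul.
Proof.
move=> [a u] [b v] [c w]; congr pair; rewrite /= ?mulrA //.
by rewrite !scalerDr !scalerA addrA (mulrC c a) (mulrC c b).
Qed.

Fact sqz_mulC : commutative sqz_mul.
Proof. by move=> [a u] [b v]; congr pair; rewrite /= 1?mulrC 1?addrC. Qed.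

Fact sqz_mul1 : left_id sqz_one sqz_mul.
Proof. by case=> [a u]; rewrite /sqz_mul /= mul1r scale1r scaler0 addr0. Qed.

Fact sqz_mulDl : left_distributive sqz_mul +%R.
Proof.
move=> [a u] [b v] [c w]; congr pair; rewrite /= ?mulrDl //.
by rewrite scalerDl scalerDr addrACA.
Qed.

Fact sqz_one_neq0 : sqz_one != 0.
Proof. by apply/eqP => -[/eqP]; rewrite oner_eq0. Qed.

HB.instance Definition _ := GRing.Zmodule_isComNzRing.Build E
  sqz_mulA sqz_mulC sqz_mul1 sqz_mulDl sqz_one_neq0.

Definition sqz_inj (u : A) : E := (0, u).

Fact sqz_inj_is_zmod_morphism : zmod_morphism sqz_inj.
Proof. by move=> u v; congr pair; rewrite /= subr0. Qed.

HB.instance Definition _ :=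
  GRing.isZmodMorphism.Build A E sqz_inj sqz_inj_is_zmod_morphism.

Lemma sqz_injI : injective sqz_inj.
Proof. by move=> u v []. Qed.

End SquareZeroExtension.

(* The multiplication and the twist are kept as bare functions: with the bundled
   [hmul] and [htwist], the rewriting below is slower by two orders of
   magnitude. *)
Section PreMalcev.

Variables (K : fieldType) (A : lmodType K).
Variables (dot : A -> A -> A) (alpha : A -> A).
Hypothesis dotDl : forall x y z, dot (x + y) z = dot x z + dot y z.
Hypothesis dotNl : forall x y, dot (- x) y = - dot x y.
Hypothesis dotDr : forall x y z, dot x (y + z) = dot x y + dot x z.
Hypothesis dotNr : forall x y, dot x (- y) = - dot x y.
Hypothesis alphaD : forall x y, alpha (x + y) = alpha x + alpha y.
Hypothesis alphaN : forall x, alpha (- x) = - alpha x.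
Hypothesis alphaM : forall x y, alpha (dot x y) = dot (alpha x) (alpha y).

Let expand := (alphaD, alphaN, alphaM, dotDl, dotNl, dotDr, dotNr).

Definition bracket (x y : A) : A := dot x y - dot y x.

Local Notation br := bracket.

Definition jacobian (x y z : A) : A :=
  br (br x y) (alpha z) + br (br y z) (alpha x) + br (br z x) (alpha y).

Definition preMalcevDefect (x y z t : A) : A :=
  dot (br (alpha y) (alpha z)) (alpha (dot x t))
  + dot (br (br x y) (alpha z)) (alpha (alpha t))
  + dot (alpha (alpha y)) (dot (br x z) (alpha t))
  - dot (alpha (alpha x)) (dot (alpha y) (dot z t))
  + dot (alpha (alpha z)) (dot (alpha x) (dot y t)).

Definition sagleDefect (a b c d : A) : A :=
  br (alpha (br a c)) (alpha (br b d))
  - br (br (br a b) (alpha c)) (alpha (alpha d))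
  - br (br (br b c) (alpha d)) (alpha (alpha a))
  - br (br (br c d) (alpha a)) (alpha (alpha b))
  - br (br (br d a) (alpha b)) (alpha (alpha c)).

(* The coefficients solve the linear system for the 24 permuted instances of the
   Hom-pre-Malcev identity in the free Hom-algebra. *)
Lemma sagleDefectE (a b c d : A) :
  sagleDefect a b c d =
    preMalcevDefect a d b c - preMalcevDefect a c d b - preMalcevDefect a d c b
    + preMalcevDefect b a c d
    - preMalcevDefect c a d b + preMalcevDefect c b d a
    - preMalcevDefect c d a b - preMalcevDefect d a c b.
Proof.
rewrite /sagleDefect /preMalcevDefect /bracket.
rewrite !expand.
(* Both sides are now signed sums of [dot]-monomials with [alpha] applied to variables only; [ring]
   takes their images under [sqz_inj] as atoms. *)
apply: sqz_injI.
ring.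
Qed.

(** By antisymmetry [br x x] vanishes, and [br (alpha y) (br x z) = br (br z x) (alpha y)] cancels
    between the two Jacobians. *)
Lemma malcevDefectE (x y z : A) :
  jacobian (alpha x) (alpha y) (br x z) - br (jacobian x y z) (alpha (alpha x))
  = sagleDefect x x y z.
Proof.
rewrite /sagleDefect /jacobian /bracket.
rewrite !expand.
apply: sqz_injI.
ring.
Qed.

(** The sign of the third product comes from [br z x = - br x z]; the last one matches because
    [alpha] is multiplicative. *)
Lemma representationDefectE (x y z t : A) :
  dot (br (br x y) (alpha z)) (alpha (alpha t))
  - (dot (alpha (alpha x)) (dot (alpha y) (dot z t))
     - dot (alpha (alpha z)) (dot (alpha x) (dot y t))
     + dot (alpha (alpha y)) (dot (br z x) (alpha t))
     - dot (alpha (br y z)) (dot (alpha x) (alpha t)))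
  = preMalcevDefect x y z t.
Proof.
rewrite /preMalcevDefect /bracket.
rewrite !expand.
apply: sqz_injI.
ring.
Qed.

End PreMalcev.

Theorem proposition3p8 (K : fieldType) (charK0 : [pchar K]%R =i pred0)
    (A : lmodType K) (H : homAlgebra A) :
  isHomPreMalcev H <->
  isHomMalcev (commAlgebra H) /\
  isRepresentation (commAlgebra H) (leftMul H) (htwist H).
Proof.
have dotDl x y z : hmul H (x + y) z = hmul H x z + hmul H y z by exact: linearDl.
have dotNl x y : hmul H (- x) y = - hmul H x y by exact: linearNl.
have dotDr x y z : hmul H x (y + z) = hmul H x y + hmul H x z by exact: linearD.
have dotNr x y : hmul H x (- y) = - hmul H x y by exact: linearN.
have alphaD := raddfD (htwist H); have alphaN := raddfN (htwist H).
have alphaM := htwistM H.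
have repE :=
  representationDefectE dotDl dotNl dotDr dotNr alphaD alphaN alphaM.
split=> [preM | [_ [_ _ rep]] dot br x y z t]; last first.
  (* [hmul (commAlgebra H)] is convertible to [bracket (hmul H)]. *)
  rewrite -[LHS]/(preMalcevDefect (hmul H) (htwist H) x y z t) -repE.
  by apply/eqP; rewrite subr_eq0; apply/eqP/rep.
have def0 x y z t : preMalcevDefect (hmul H) (htwist H) x y z t = 0.
  exact: preM.
split; first split=> [x y|x y z].
- by rewrite !commAlgebraE opprB.
- apply/subr0_eq.
  rewrite -[LHS]/(jacobian (hmul H) (htwist H) _ _ _
                  - bracket (hmul H) (jacobian _ _ _ _ _) _).
  by rewrite malcevDefectE // sagleDefectE // !def0 !(subr0, addr0).
split=> [v a x y|x v|x y z t].
- exact: (linearPl (hmul H)).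
- exact: esym (htwistM H x v).
(* The right-hand 0 is rewritten as a defect, which [repE] turns into the difference already on the
   left. *)
- by apply/subr0_eq; rewrite -[RHS](def0 x y z t) -repE.
Qed.
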